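(* Epimorphisms in $\mathbf{Clus}$ are not necessarily surjective. More precisely, let $\Sigma_1=((x_1),\emptyset,[0])$ and $\Sigma_2=((x_1),(x_1),[0])$. Then the identity of $\mathbb{Q}(x_1)$ induces a rooted cluster morphism $f:\mathbb{Z}[x_1]=\mathcal{A}(\Sigma_1)\to\mathcal{A}(\Sigma_2)=\mathbb{Z}[x_1,\frac{2}{x_1}]$ which is both a monomorphism and an epimorphism in $\mathbf{Clus}$, but which is not surjective and is not an isomorphism in $\mathbf{Clus}$.
   Context: Countable means of cardinality at most $\aleph_0$; rings are unital and ring homomorphisms preserve identities. A seed is a triple $\Sigma=(\mathbf{x},\mathbf{ex},B)$ where $\mathbf{x}$ is a countable set of indeterminates over $\mathbb{Z}$ (the cluster), $\mathbf{ex}\subset\mathbf{x}$ is the set of exchangeable variables (those in $\mathbf{x}\setminus\mathbf{ex}$ are frozen), and $B=(b_{xy})_{x,y\in\mathbf{x}}$ is an integer matrix which is locally finite (each row and column has finite support) and skew-symmetrisable (there are positive integers $d_x$ with $d_xb_{xy}=-d_yb_{yx}$). Put $\mathcal{F}_\Sigma=\mathbb{Q}(x\mid x\in\mathbf{x})$. For $x\in\mathbf{ex}$ the mutation $\mu_x(\Sigma)=(\mathbf{x}',\mathbf{ex}',B')$ is obtained by replacing $x$ in $\mathbf{x}$ and in $\mathbf{ex}$ by $x'\in\mathcal{F}_\Sigma$ with $xx'=\prod_{b_{xy}>0}y^{b_{xy}}+\prod_{b_{xy}<0}y^{-b_{xy}}$ (empty products equal $1$), and (identifying the index $x'$ with $x$)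 $b'_{yz}=-b_{yz}$ if $x\in\{y,z\}$ and $b'_{yz}=b_{yz}+\frac12(|b_{yx}|b_{xz}+b_{yx}|b_{xz}|)$ otherwise. For $y\in\mathbf{x}$, $\mu_{x,\Sigma}(y)$ is the variable of $\mu_x(\Sigma)$ corresponding to $y$: it is $y$ if $y\ne x$ and $x'$ if $y=x$. A sequence $(x_1,\dots,x_l)$ is $\Sigma$-admissible if $x_1$ is exchangeable in $\Sigma$ and each $x_i$ ($i\ge2$) is exchangeable in $\mu_{x_{i-1}}\circ\cdots\circ\mu_{x_1}(\Sigma)$; $\mu_{x_l}\circ\cdots\circ\mu_{x_1,\Sigma}(y)$ denotes the variable corresponding to $y\in\mathbf{x}$ after these mutations. $\mathrm{Mut}(\Sigma)$ is the set of seeds obtained from $\Sigma$ by mutating along finite (possibly empty) admissible sequences. The rooted cluster algebra $\mathcal{A}(\Sigma)$ is the $\mathbb{Z}$-subalgebra of $\mathcal{F}_\Sigma$ generated by all variables in clusters of seeds in $\mathrm{Mut}(\Sigma)$, considered together with its initial seed $\Sigma$. For seeds $\Sigma=(\mathbf{x},\mathbf{ex},B)$, $\Sigma'=(\mathbf{x}',\mathbf{ex}',B')$ and a map $f:\mathcal{A}(\Sigma)\to\mathcal{A}(\Sigma')$, a sequence $(x_1,\dots,x_n)$ is $(f,\Sigma,\Sigma')$-biadmissible if it is $\Sigma$-admissible and $(f(x_1),\dots,f(x_n))$ is $\Sigma'$-admissible. A rooted cluster morphism $\mathcal{A}(\Sigma)\to\mathcal{A}(\Sigma')$ is a ring homomorphism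 $f$ such that (CM1) $f(\mathbf{x})\subset\mathbf{x}'\sqcup\mathbb{Z}$; (CM2) $f(\mathbf{ex})\subset\mathbf{ex}'\sqcup\mathbb{Z}$; (CM3) for every $(f,\Sigma,\Sigma')$-biadmissible sequence $(x_1,\dots,x_n)$ and every $y\in\mathbf{x}$, $f(\mu_{x_n}\circ\cdots\circ\mu_{x_1,\Sigma}(y))=\mu_{f(x_n)}\circ\cdots\circ\mu_{f(x_1),\Sigma'}(f(y))$, where mutations fix integers. $\mathbf{Clus}$ is the category whose objects are rooted cluster algebras and whose morphisms are rooted cluster morphisms. *)

(* Defs.v *)
From HB Require Import structures.
From mathcomp Require Import all_boot all_order all_algebra.
From mathcomp Require Import finmap.
From mathcomp.classical Require Import boolp classical_sets functions cardinality fsbigop.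
From mathcomp.multinomials Require Import monalg.

Set Implicit Arguments.
Unset Strict Implicit.
Unset Printing Implicit Defensive.

Import GRing.Theory Num.Theory.

Local Open Scope classical_set_scope.
Local Open Scope ring_scope.

Section Digits.
Local Open Scope nat_scope.

Lemma digits_inj (N K : nat) (d e : nat -> nat) :
    (forall j, d j < N) -> (forall j, e j < N) ->
    \sum_(j < K) d j * N ^ j = \sum_(j < K) e j * N ^ j ->
  forall j, j < K -> d j = e j.
Proof.
elim: K d e => [//|K IH] d e dN eN.
have N_gt0 : 0 < N by apply: leq_ltn_trans (dN 0).
have shift (f : nat -> nat) : \sum_(j < K.+1) f j * N ^ j =
    (\sum_(j < K) f j.+1 * N ^ j) * N + f 0.
  rewrite big_ord_recl expn0 muln1 addnC big_distrl /=; congr (_ + _).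
  by apply: eq_bigr => j _; rewrite expnSr mulnA.
rewrite !shift => eq_de.
have d0e0 : d 0 = e 0.
  by have := congr1 (modn^~ N) eq_de; rewrite /= !modnMDl !modn_small.
have eqS := congr1 (divn^~ N) eq_de; rewrite /= !divnMDl // !divn_small // in eqS.
rewrite !addn0 in eqS.
by case=> [//|j] ltjK; apply: (IH (fun j => d j.+1) (fun j => e j.+1)).
Qed.

End Digits.

Definition polyQ (I : countType) := {malg rat[{cmonom I}]}.

Section PolyQDomain.
Variable I : countType.
Implicit Types (m : {cmonom I}) (p q : {malg rat[{cmonom I}]}).

Let digit m (j : nat) : nat := if @pickle_inv I j is Some i then m i else 0%N.

Let weight (N K : nat) m : nat := (\sum_(j < K) digit m j * N ^ j)%N.

(* Kronecker substitution *)
Let kron (N K : nat) m : {poly rat} := 'X^(weight N K m).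

Fact kron_mmorphism N K : mmorphism (kron N K).
Proof.
split=> [m m'|]; rewrite /kron /weight; last first.
  by rewrite big1 // => j _; rewrite /digit; case: pickle_inv => // i; rewrite cm1.
rewrite -exprD -big_split /=; congr ('X^_); apply: eq_bigr => j _.
by rewrite /digit -mulnDl; case: pickle_inv => // i; rewrite cmM.
Qed.

HB.instance Definition _ N K :=
  isMultiplicative.Build _ _ (kron N K) (kron_mmorphism N K).

Let bounded (N K : nat) (s : seq {cmonom I}) := forall m i, m \in s ->
  (m i < N)%N /\ (m i != 0%N -> (choice.pickle i < K)%N).

Let bounded_ex (s : seq {cmonom I}) : exists N K, bounded N K s.
Proof.
have le_max (T : eqType) (r : seq T) (F : T -> nat) x :
  x \in r -> (F x <= \max_(y <- r) F y)%N by move=> xr; apply: leq_bigmax_seq.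
exists (\max_(m <- s) \max_(i <- finsupp m) m i).+1,
       (\max_(m <- s) \max_(i <- finsupp m) choice.pickle i).+1 => m i ms.
split=> [|mi]; rewrite ltnS; last first.
  apply: leq_trans (le_max _ _ (fun m : {cmonom I} =>
    \max_(i <- finsupp m) choice.pickle i)%N _ ms).
  by apply: (le_max _ _ choice.pickle); rewrite -cmE_neq0.
case: (mdomP m i) => // im.
apply: leq_trans (le_max _ _ (fun m : {cmonom I} =>
  \max_(i <- finsupp m) m i)%N _ ms).
exact: (le_max _ _ (fun i => m i)).
Qed.

Let weight_inj N K s : bounded N K s -> {in s &, injective (weight N K)}.
Proof.
move=> bnd m m' ms m's eqw; apply/eqP/cmP => i.
have digitN m0 : m0 \in s -> forall j, (digit m0 j < N)%N.
  move=> m0s j; rewrite /digit; case: pickle_inv => [k|]; first by case: (bnd m0 k m0s).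
  by apply: leq_ltn_trans (bnd m i ms).1.
have [ltK|geK] := ltnP (choice.pickle i) K.
  have := digits_inj (digitN _ ms) (digitN _ m's) eqw ltK.
  by rewrite /digit pickleK_inv.
have z m0 : m0 \in s -> m0 i = 0%N.
  move=> m0s; apply/eqP; apply: contraTT geK => /(bnd m0 i m0s).2.
  by rewrite -ltnNge.
by rewrite !z.
Qed.

Let kron_neq0 N K p :
  bounded N K (msupp p) -> p != 0 -> mmap polyC (kron N K) p != 0.
Proof.
move=> bnd; rewrite -msupp_eq0 => /fset0Pn[m mp].
apply/eqP => /(congr1 (fun r : {poly rat} => r`_(weight N K m))).
rewrite coef0 mmapE coef_sum (big_fsetD1 m) //= big1_fset => [|m' + _].
  rewrite coefCM coefXn eqxx mulr1 addr0 => /eqP.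
  by rewrite mcoeff_eq0 mp.
rewrite in_fsetD1 => /andP[m'm m'p]; rewrite coefCM coefXn.
case: eqP => [/(weight_inj bnd) e|_]; last by rewrite mulr0.
by rewrite e ?eqxx in m'm.
Qed.

Lemma malg_mulf_eq0 p q : p * q = 0 -> (p == 0) || (q == 0).
Proof.
move=> pq0; apply/negP => /negP; rewrite negb_or => /andP[p0 q0].
have [N [K bnd]] := bounded_ex (msupp p ++ msupp q).
have bndp : bounded N K (msupp p) by move=> m i mp; apply: bnd; rewrite mem_cat mp.
have bndq : bounded N K (msupp q) by move=> m i mp; apply: bnd; rewrite mem_cat mp orbT.
have := congr1 (mmap polyC (kron N K)) pq0; rewrite rmorphM raddf0 => /eqP.
by rewrite mulf_eq0 (negPf (kron_neq0 bndp p0)) (negPf (kron_neq0 bndq q0)).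
Qed.

End PolyQDomain.

HB.instance Definition _ (I : countType) := GRing.ComNzRing.on (polyQ I).

Section PolyQInverse.
Variable I : countType.
Implicit Types p : polyQ I.

Definition polyQ_unit : {pred polyQ I} := fun p => `[< exists q, q * p = 1 >].

Definition polyQ_inv p : polyQ I :=
  if pselect (exists q, q * p = 1) is left inv_p then projT1 (cid inv_p) else p.

Fact polyQ_mulVp : {in polyQ_unit, left_inverse 1 polyQ_inv *%R}.
Proof.
by move=> p /asboolP pU; rewrite /polyQ_inv; case: pselect => // e; case: cid.
Qed.

Fact polyQ_unitPl p q : q * p = 1 -> polyQ_unit p.
Proof. by move=> qp1; apply/asboolP; exists q. Qed.

Fact polyQ_inv_out : {in [predC polyQ_unit], polyQ_inv =1 id}.
Proof.
move=> p /negP pU; rewrite /polyQ_inv; case: pselect => // e.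
by case: pU; apply/asboolP.
Qed.

End PolyQInverse.

HB.instance Definition _ (I : countType) :=
  GRing.ComNzRing_hasMulInverse.Build (polyQ I)
    (@polyQ_mulVp I) (@polyQ_unitPl I) (@polyQ_inv_out I).

HB.instance Definition _ (I : countType) :=
  GRing.ComUnitRing_isIntegral.Build (polyQ I) (@malg_mulf_eq0 I).

(* The field Q(x_i | i in I), for a possibly infinite countable I. *)
Notation ratfun I := {fraction polyQ I}.

Definition indet (I : countType) (i : I) : ratfun I :=
  tofrac (<< ucm i >>%R : polyQ I).

Section LabelledSeeds.
Variables (I : choiceType) (F : fieldType).

(* A seed in the ambient field F whose variables are labelled by I: a mutation
   replaces the variable of label k and keeps all the labels, which identifies
   the index of the new variable with that of the old one. *)
Record labelled_seed := LabelledSeed {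
  svar : I -> F;
  sexch : set I;
  smat : I -> I -> int
}.

Implicit Types S : labelled_seed.

Definition mutate_mat (b : I -> I -> int) (k i j : I) : int :=
  if (i == k) || (j == k) then - b i j
  else b i j + ((`|b i k| * b k j + b i k * `|b k j|) %/ 2)%Z.

(* The variable created by a mutation is exchange_sum S k / svar S k; here
   svar S k != 0, the variables being algebraically independent. The products
   are over finite supports because smat S is locally finite. *)
Definition exchange_sum S (k : I) : F :=
  \big[*%R/1]_(j \in [set j | 0 < smat S k j]) (svar S j ^ smat S k j) +
  \big[*%R/1]_(j \in [set j | smat S k j < 0]) (svar S j ^ (- smat S k j)).

Definition mutate (k : I) S : labelled_seed := {|
  svar := fun i => if i == k then exchange_sum S k / svar S k else svar S i;
  sexch := sexch S;
  smat := mutate_mat (smat S) k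
|}.

(* mutate_along S xs S' : the sequence xs of elements of F is S-admissible, and
   mutating S successively at these variables yields S'. *)
Inductive mutate_along S : seq F -> labelled_seed -> Prop :=
| mutate_nil : mutate_along S [::] S
| mutate_cons k xs S' : sexch S k -> mutate_along (mutate k S) xs S' ->
    mutate_along S (svar S k :: xs) S'.

(* When S' is obtained from S by a sequence of mutations, the image of an
   element of the cluster of S, or of an integer, under these mutations. *)
Inductive mutated S S' : F -> F -> Prop :=
| mutated_var i : mutated S S' (svar S i) (svar S' i)
| mutated_int (n : int) : mutated S S' n%:~R n%:~R.

End LabelledSeeds.

Inductive subring_gen (R : pzRingType) (X : set R) : set R :=
| subring_gen_in x : X x -> subring_gen X x
| subring_gen1 : subring_gen X 1
| subring_genB x y : subring_gen X x -> subring_gen X y -> subring_gen X (x - y)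
| subring_genM x y : subring_gen X x -> subring_gen X y -> subring_gen X (x * y).

(* A seed whose cluster is the set of indeterminates indet i, i : idx. *)
Record seed := Seed {
  idx : countType;
  exch : set idx;
  bmat : idx -> idx -> int;
  bmat_finite_rows : forall x, finite_set [set y | bmat x y != 0];
  bmat_finite_cols : forall y, finite_set [set x | bmat x y != 0];
  bmat_skew_symmetrisable : exists2 d : idx -> int, forall x, 0 < d x &
    forall x y, d x * bmat x y = - (d y * bmat y x)
}.

Arguments exch : clear implicits.
Arguments bmat : clear implicits.

Section RootedClusterAlgebra.
Variable Sigma : seed.

Definition initial : labelled_seed (idx Sigma) (ratfun (idx Sigma)) := {|
  svar := @indet (idx Sigma);
  sexch := exch Sigma;
  smat := bmat Sigma
|}.

Definition cluster_variables : set (ratfun (idx Sigma)) :=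
  [set z | exists xs S i, mutate_along initial xs S /\ z = svar S i].

Definition cluster_ring : {pred ratfun (idx Sigma)} :=
  fun z => `[< subring_gen cluster_variables z >].

Fact cluster_ring_subring_closed : subring_closed cluster_ring.
Proof.
split; first exact/asboolP/subring_gen1.
- by move=> x y /asboolP x_in /asboolP y_in; apply/asboolP/subring_genB.
- by move=> x y /asboolP x_in /asboolP y_in; apply/asboolP/subring_genM.
Qed.

HB.instance Definition _ :=
  GRing.isSubringClosed.Build _ cluster_ring cluster_ring_subring_closed.

Record rooted_cluster_algebra := RootedClusterAlgebra {
  cluster_val : ratfun (idx Sigma);
  _ : cluster_val \in cluster_ring
}.

HB.instance Definition _ := [isSub for cluster_val].
HB.instance Definition _ := [Choice of rooted_cluster_algebra by <:].
HB.instance Definition _ :=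
  [SubChoice_isSubComNzRing of rooted_cluster_algebra by <:].

Fact mutate_along_cluster_ring xs S i :
  mutate_along initial xs S -> svar S i \in cluster_ring.
Proof. by move=> mutS; apply/asboolP/subring_gen_in; exists xs, S, i. Qed.

Definition mutated_variable xs S (mutS : mutate_along initial xs S) i :
  rooted_cluster_algebra := RootedClusterAlgebra (mutate_along_cluster_ring i mutS).

Definition initial_variable : idx Sigma -> rooted_cluster_algebra :=
  mutated_variable (mutate_nil initial).

Definition integers : set rooted_cluster_algebra := range intr.

End RootedClusterAlgebra.

Arguments cluster_variables : clear implicits.
Arguments cluster_ring : clear implicits.
Arguments initial_variable : clear implicits.
Arguments integers : clear implicits.

Notation "\A( Sigma )" := (rooted_cluster_algebra Sigma)
  (at level 8, format "\A( Sigma )") : type_scope.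

Record rooted_cluster_morphism (Sigma Sigma' : seed) := RootedClusterMorphism {
  rcm_fun :> {rmorphism \A(Sigma) -> \A(Sigma')};
  rcm_CM1 : forall i,
    (range (initial_variable Sigma') `|` integers Sigma')
      (rcm_fun (initial_variable Sigma i));
  rcm_CM2 : forall i, exch Sigma i ->
    (initial_variable Sigma' @` exch Sigma' `|` integers Sigma')
      (rcm_fun (initial_variable Sigma i));
  rcm_CM3 : forall (xs : seq \A(Sigma)) S S'
      (mutS : mutate_along (initial Sigma) [seq val x | x <- xs] S),
    mutate_along (initial Sigma') [seq val (rcm_fun x) | x <- xs] S' ->
    forall i, mutated (initial Sigma') S'
      (val (rcm_fun (initial_variable Sigma i))) (val (rcm_fun (mutated_variable mutS i)))
}.

(* Morphisms of Clus are compared, and composed, as maps. *)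

Definition clus_mono (Sigma Sigma' : seed)
    (f : rooted_cluster_morphism Sigma Sigma') :=
  forall (T : seed) (g h : rooted_cluster_morphism T Sigma),
    f \o g =1 f \o h -> g =1 h.

Definition clus_epi (Sigma Sigma' : seed)
    (f : rooted_cluster_morphism Sigma Sigma') :=
  forall (T : seed) (g h : rooted_cluster_morphism Sigma' T),
    g \o f =1 h \o f -> g =1 h.

Definition clus_iso (Sigma Sigma' : seed)
    (f : rooted_cluster_morphism Sigma Sigma') :=
  exists g : rooted_cluster_morphism Sigma' Sigma, cancel f g /\ cancel g f.

Section OneVariable.
Variable E : set unit.

Let b (x y : unit) : int := 0.

Fact one_variable_finite_rows x : finite_set [set y | b x y != 0].
Proof. exact: finite_finset. Qed.

Fact one_variable_finite_cols y : finite_set [set x | b x y != 0].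
Proof. exact: finite_finset. Qed.

Fact one_variable_skew_symmetrisable : exists2 d : unit -> int,
  forall x, 0 < d x & forall x y, d x * b x y = - (d y * b y x).
Proof. by exists (fun=> 1) => // x y; rewrite mulr0 oppr0. Qed.

Definition one_variable_seed : seed := Seed E one_variable_finite_rows
  one_variable_finite_cols one_variable_skew_symmetrisable.

End OneVariable.

Definition x1 : ratfun unit := indet tt.
Definition Sigma1 : seed := one_variable_seed set0.
Definition Sigma2 : seed := one_variable_seed setT.

(* Main.v *)
(** The inclusion [Z[x1] -> Z[x1, 2/x1]] is an epimorphism because two morphisms
    [g], [h] out of [A(Sigma2)] that agree on [x1] satisfy
    [g x1 * g (2/x1) = 2 = g x1 * h (2/x1)] in a domain of characteristic 0,
    so that [g x1] can be cancelled.  It misses [2/x1]: an identity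
    [p * x1 = 2] with [p] a polynomial fails in the constant coefficient. *)
Require Import Defs.
From HB Require Import structures.
From mathcomp Require Import all_boot all_order all_algebra.
From mathcomp Require Import finmap.
From mathcomp.classical Require Import boolp classical_sets fsbigop.
From mathcomp.multinomials Require Import monalg.

Set Implicit Arguments.
Unset Strict Implicit.
Unset Printing Implicit Defensive.

Import GRing.Theory.
Local Open Scope classical_set_scope.
Local Open Scope ring_scope.

Lemma subring_gen_sub (R : pzRingType) (X Y : set R) :
  X `<=` subring_gen Y -> subring_gen X `<=` subring_gen Y.
Proof.
move=> XY x; elim=> {x} [x /XY //||x y _ xY _ yY|x y _ xY _ yY].
- exact: subring_gen1.
- exact: subring_genB.
- exact: subring_genM.
Qed.

(** * Constant coefficients and denominators in the fraction field *)

Definition const_coef {I : countType} (p : polyQ I) : rat :=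
  mcoeff (@mone {cmonom I}) p.

(** A product of monomials is 1 only when both factors are, so taking the constant coefficient is
    the ring morphism of evaluation at 0. *)
Lemma const_coefM (I : countType) (p q : polyQ I) :
  const_coef (p * q) = const_coef p * const_coef q.
Proof. exact: (rmorphM (mcoeff (@mone {cmonom I}))). Qed.

Lemma const_coef_nat (I : countType) n : const_coef (n%:R : polyQ I) = n%:R.
Proof. exact: (rmorph_nat (mcoeff (@mone {cmonom I}))). Qed.

Lemma const_coef_ucm (I : countType) (i : I) :
  const_coef (<< ucm i >>%R : polyQ I) = 0.
Proof.
rewrite /const_coef mcoeffU1; case: eqP => // /(congr1 (fun m : {cmonom I} => m i)).
by rewrite ucmE eqxx cm1.
Qed.

Lemma ratfun2_neq0 (I : countType) : 2 != 0 :> ratfun I.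
Proof.
rewrite -(rmorph_nat (@tofrac (polyQ I))) tofrac_eq0; apply/eqP.
by move=> /(congr1 const_coef); rewrite const_coef_nat (const_coef_nat _ 0).
Qed.

Lemma indet_neq0 (I : countType) (i : I) : indet i != 0.
Proof.
rewrite /indet tofrac_eq0; apply/eqP => /(congr1 (mcoeff (ucm i))).
by rewrite mcoeffUU mcoeff0.
Qed.

Lemma div2_indet_not_poly (I : countType) (i : I) (p : polyQ I) :
  2 / indet i != tofrac p.
Proof.
apply/eqP => /(canRL (divfK (indet_neq0 i))).
rewrite -(rmorph_nat (@tofrac (polyQ I))) -rmorphM => /eqP; rewrite tofrac_eq => /eqP.
by move/(congr1 const_coef); rewrite const_coefM const_coef_ucm mulr0 const_coef_nat.
Qed.

(** * Generators and cancellation in a rooted cluster algebra *)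

Lemma cluster_ringE Sigma :
  [set` cluster_ring Sigma] = subring_gen (cluster_variables Sigma).
Proof. by apply/seteqP; split=> z /= /asboolP. Qed.

(** The elements on which [g] and [h] agree form a subring. [X] is arbitrary so that a small
    generating set can replace the set of all cluster variables. *)
Lemma rooted_cluster_algebra_gen_eq Sigma (T : pzRingType)
    (g h : {rmorphism \A(Sigma) -> T}) (X : set (ratfun (idx Sigma))) :
  [set` cluster_ring Sigma] = subring_gen X ->
  (forall a, X (val a) -> g a = h a) -> g =1 h.
Proof.
move=> genX gh a.
have aX : subring_gen X (val a) by rewrite -genX; exact: valP.
(* The induction runs through elements of the ambient field, so each one has to carry its own lift
   [b] to the algebra. *)
suff [b [/val_inj <- //]] : exists b, val b = val a /\ g b = h b.
elim: {a}(val a) / aX =>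
    [x Xx||_ _ _ [b [<- gb]] _ [c [<- gc]]|_ _ _ [b [<- gb]] _ [c [<- gc]]].
- have x_in : x \in cluster_ring Sigma.
    by have : [set` cluster_ring Sigma] x by rewrite genX; apply: subring_gen_in.
  by exists (RootedClusterAlgebra x_in); split=> //; apply: gh.
- by exists 1; rewrite !rmorph1.
- by exists (b - c); rewrite !rmorphB gb gc.
- by exists (b * c); rewrite !rmorphM gb gc.
Qed.

(** Cancellation is inherited from the ambient field along the injective morphism [val]. *)
Lemma rooted_cluster_algebra_mulfI Sigma (a : \A(Sigma)) :
  a != 0 -> injective ( *%R a).
Proof.
move=> a0 b c /(congr1 val); rewrite !rmorphM => /mulfI bc.
by apply/val_inj/bc; apply: contra_neq a0 => a0; apply: val_inj; rewrite a0 rmorph0.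
Qed.

Lemma rooted_cluster_algebra2_neq0 Sigma : 2 != 0 :> \A(Sigma).
Proof.
apply/eqP => /(congr1 val); rewrite rmorph_nat rmorph0.
by apply/eqP; exact: ratfun2_neq0.
Qed.

(** * Mutations with zero matrix and the two cluster algebras *)

Lemma exchange_sum_zero (I : choiceType) (F : fieldType) (S : labelled_seed I F) k :
  (forall j, smat S k j = 0) -> exchange_sum S k = 2.
Proof.
move=> S_0; rewrite /exchange_sum.
have -> : [set j | 0 < smat S k j] = set0.
  by apply/seteqP; split=> j //=; rewrite S_0.
have -> : [set j | smat S k j < 0] = set0.
  by apply/seteqP; split=> j //=; rewrite S_0.
by rewrite !fsbig_set0.
Qed.

(** Mutation keeps the zero matrix and replaces the variable [v] by [2 / v], an involution that
    swaps [x] and [2 / x]. *)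
Lemma mutate_along_one_variable (F : fieldType) (S S' : labelled_seed unit F) xs x :
  x != 0 -> (2 != 0 :> F) -> smat S tt tt = 0 -> [set x; 2 / x] (svar S tt) ->
  mutate_along S xs S' -> [set x; 2 / x] (svar S' tt).
Proof.
move=> x0 F2 S0 Sx mutS; elim: mutS S0 Sx => {S S' xs} // S [] xs S' _ _ IH S0 Sx.
apply: IH => /=; first by rewrite /mutate_mat eqxx S0 oppr0.
rewrite exchange_sum_zero; last by case.
by case: Sx => ->; [right | left; rewrite invf_div mulrCA divff // mulr1].
Qed.

Lemma cluster_ring_Sigma1 : [set` cluster_ring Sigma1] = subring_gen [set x1].
Proof.
rewrite cluster_ringE; congr subring_gen; apply/seteqP; split=> z.
  (* Nothing is exchangeable in [Sigma1], so only the empty sequence is admissible. *)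
  by case=> xs [S [[] [mutS ->]]]; case: mutS.
by move=> ->; exists [::], (initial Sigma1), tt; split=> //; apply: mutate_nil.
Qed.

Lemma cluster_ring_Sigma2 :
  [set` cluster_ring Sigma2] = subring_gen [set x1; 2 / x1].
Proof.
rewrite cluster_ringE; congr subring_gen; apply/seteqP; split=> z.
  case=> xs [S [[] [mutS ->]]].
  apply: (mutate_along_one_variable (indet_neq0 tt) (ratfun2_neq0 _) _ _ mutS) => //.
  by left.
case=> ->; first by exists [::], (initial Sigma2), tt; split=> //; apply: mutate_nil.
(* One mutation at [x1] already creates [2 / x1]. *)
exists [:: x1], (mutate tt (initial Sigma2)), tt; split.
  exact: (@mutate_cons _ _ (initial Sigma2) tt _ _ I (mutate_nil _)).
by rewrite /= exchange_sum_zero.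
Qed.

(** * The inclusion as a rooted cluster morphism *)

Fact Sigma1_sub_Sigma2 (z : ratfun unit) :
  z \in cluster_ring Sigma1 -> z \in cluster_ring Sigma2.
Proof.
suff: [set` cluster_ring Sigma1] `<=` [set` cluster_ring Sigma2] by apply.
rewrite cluster_ring_Sigma1 cluster_ring_Sigma2; apply: subring_gen_sub => _ ->.
by apply: subring_gen_in; left.
Qed.

Definition incl12_fun (a : \A(Sigma1)) : \A(Sigma2) :=
  RootedClusterAlgebra (Sigma1_sub_Sigma2 (valP a)).

Fact incl12_zmod_morphism : zmod_morphism incl12_fun.
Proof. by move=> a b; exact: val_inj. Qed.

Fact incl12_monoid_morphism : monoid_morphism incl12_fun.
Proof. by split=> [|a b]; exact: val_inj. Qed.

HB.instance Definition _ :=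
  GRing.isZmodMorphism.Build _ _ incl12_fun incl12_zmod_morphism.
HB.instance Definition _ :=
  GRing.isMonoidMorphism.Build _ _ incl12_fun incl12_monoid_morphism.

Lemma incl12_initial i :
  incl12_fun (initial_variable Sigma1 i) = initial_variable Sigma2 i.
Proof. exact: val_inj. Qed.

Fact incl12_CM1 i : (range (initial_variable Sigma2) `|` integers Sigma2)
  (incl12_fun (initial_variable Sigma1 i)).
Proof. by left; exists i => //; rewrite incl12_initial. Qed.

Fact incl12_CM2 i : exch Sigma1 i ->
  (initial_variable Sigma2 @` exch Sigma2 `|` integers Sigma2)
    (incl12_fun (initial_variable Sigma1 i)).
Proof. by []. Qed.

(** A biadmissible sequence is in particular [Sigma1]-admissible, hence empty, and both seeds are
    still the initial ones. *)
Fact incl12_CM3 (xs : seq \A(Sigma1)) S S'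
    (mutS : mutate_along (initial Sigma1) [seq val x | x <- xs] S) :
    mutate_along (initial Sigma2) [seq val (incl12_fun x) | x <- xs] S' ->
  forall i, mutated (initial Sigma2) S'
    (val (incl12_fun (initial_variable Sigma1 i)))
    (val (incl12_fun (mutated_variable mutS i))).
Proof.
move=> mutS' i; rewrite /=.
case: xs mutS mutS' => [|x xs] mutS mutS'; last by inversion mutS.
have -> : S = initial Sigma1 by inversion mutS.
have -> : S' = initial Sigma2 by inversion mutS'.
exact: (mutated_var (initial Sigma2)).
Qed.

Definition incl12 : rooted_cluster_morphism Sigma1 Sigma2 :=
  RootedClusterMorphism incl12_CM1 incl12_CM2 incl12_CM3.

(** * Monomorphism, epimorphism, failure of surjectivity *)

Lemma incl12_inj : injective incl12.
Proof. by move=> a b /(congr1 val) ab; exact: val_inj. Qed.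

Lemma incl12_mono : clus_mono incl12.
Proof. by move=> T g h gh a; apply: incl12_inj; apply: gh. Qed.

Lemma incl12_epi : clus_epi incl12.
Proof.
move=> T g h gh.
pose x := initial_variable Sigma2 tt.
have ghx : g x = h x.
  by have := gh (initial_variable Sigma1 tt); rewrite /= incl12_initial.
apply: (rooted_cluster_algebra_gen_eq cluster_ring_Sigma2) => a.
(* Only the generators [x1] and [2 / x1] need checking; the second is handled through the relation
   [x * a = 2]. *)
case=> [ax|a2]; first by have -> : a = x by apply: val_inj.
have xa : x * a = 2.
  by apply: val_inj; rewrite rmorphM rmorph_nat; move: a2 => /= ->;
    rewrite mulrC divfK // indet_neq0.
have gxa : g x * g a = 2 by rewrite -rmorphM xa rmorph_nat.
apply: (@rooted_cluster_algebra_mulfI _ (g x)).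
  (* If [g x] vanished, then so would [2 = g x * g a] in [\A(T)]. *)
  apply/eqP => gx0; have := rooted_cluster_algebra2_neq0 T.
  by rewrite -gxa gx0 mul0r eqxx.
by rewrite gxa ghx -rmorphM xa rmorph_nat.
Qed.

(** Polynomials are closed under the ring operations. Rational coefficients suffice, since the
    obstruction to [2 / x1] is a constant coefficient that would have to be both 2 and 0. *)
Lemma subring_gen_x1_poly (z : ratfun unit) :
  subring_gen [set x1] z -> exists p, z = tofrac p.
Proof.
elim=> {z} [_ ->||_ _ _ [p ->] _ [q ->]|_ _ _ [p ->] _ [q ->]].
- by exists << ucm tt >>%R.
- by exists 1; rewrite rmorph1.
- by exists (p - q); rewrite rmorphB.
- by exists (p * q); rewrite rmorphM.
Qed.

Lemma incl12_not_surj : range incl12 <> setT.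
Proof.
move=> rg.
have x2_in : 2 / x1 \in cluster_ring Sigma2.
  suff : [set` cluster_ring Sigma2] (2 / x1) by [].
  by rewrite cluster_ring_Sigma2; apply: subring_gen_in; right.
have : range incl12 (RootedClusterAlgebra x2_in) by rewrite rg.
case=> a _ /(congr1 val) /= ax2.
have : [set` cluster_ring Sigma1] (val a) by exact: valP a.
rewrite cluster_ring_Sigma1 => /subring_gen_x1_poly[p] /=.
by rewrite ax2 => /eqP; apply/negP/div2_indet_not_poly.
Qed.

Lemma clus_iso_surj Sigma Sigma' (f : rooted_cluster_morphism Sigma Sigma') :
  clus_iso f -> range f = setT.
Proof. by case=> g [_ gK]; apply/seteqP; split=> // b _; exists (g b). Qed.

Theorem mainTheorem5 :
  ~ (forall (Sigma Sigma' : seed) (f : rooted_cluster_morphism Sigma Sigma'),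
       clus_epi f -> range f = setT) /\
  [set` cluster_ring Sigma1] = subring_gen [set x1] /\
  [set` cluster_ring Sigma2] = subring_gen [set x1; 2 / x1] /\
  exists f : rooted_cluster_morphism Sigma1 Sigma2,
    (forall a, val (f a) = val a :> ratfun unit) /\
    clus_mono f /\ clus_epi f /\ range f <> setT /\ ~ clus_iso f.
Proof.
split; first by move=> surj; apply/incl12_not_surj/surj/incl12_epi.
split; first exact: cluster_ring_Sigma1.
split; first exact: cluster_ring_Sigma2.
exists incl12; split=> //; split; first exact: incl12_mono.
split; first exact: incl12_epi.
split; first exact: incl12_not_surj.
by move/clus_iso_surj/incl12_not_surj.
Qed.
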